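(* Let $A$ be an arbitrary commutative ring with unit and $\mathcal{A}(A)=1+XA[[X]]$. For $f=1+\sum_{n\ge1}a_nX^n$ and $g=1+\sum_{n\ge1}b_nX^n$ in $\mathcal{A}(A)$ define $$f\star g=1+\sum_{n\ge1}C_n(a_1,\dots,a_n,b_1,\dots,b_n)X^n,$$ where $(C_n)_{n\ge1}$ are the universal polynomials with integer coefficients described in the context. Then $(\mathcal{A}(A),\,.\,,\star)$, with ring addition the multiplication of power series and ring multiplication $\star$, is a commutative topological ring for the Krull topology. Moreover, this ring structure $(\mathcal{A}(A),\,.\,,\star)$ is a continuous extension of the eñe semiring structure on $(P_A,\,.\,,\star)$, where $P_A$ is the set of split polynomials over $A$.
   Context: Universal polynomials $C_n$: for $n\ge 1$, in $\mathbb{Z}[X_1,\dots,X_n,Y_1,\dots,Y_n,T]$ write $\prod_{k=1}^n(1-X_kT)=1+\sum_{k=1}^n\Sigma_k(X)T^k$ and $\prod_{l=1}^n(1-Y_lT)=1+\sum_{l=1}^n\Sigma_l(Y)T^l$. Then $C_n\in\mathbb{Z}[U_1,\dots,U_n,V_1,\dots,V_n]$ is the unique polynomial such that the coefficient of $T^n$ in $\prod_{k,l=1}^n(1-X_kY_lT)$ equals $C_n(\Sigma_1(X),\dots,\Sigma_n(X),\Sigma_1(Y),\dots,\Sigma_n(Y))$. Krull topology on $\mathcal{A}(A)$: the group topology in which the subgroups $1+X^nA[[X]]$, $n\ge1$, form a basis of neighborhoods of the neutral element $1$ (the zero of the ring). Split polynomials: $P_A\subset 1+XA[X]$ is the multiplicative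 semigroup of polynomials that can be written $\prod_{a\in A}(1-aX)^{n_a}$ with $n_a\in\mathbb{N}=\{0,1,2,\dots\}$, almost all zero. The eñe product on $P_A$ is $\big(\prod_a(1-aX)^{n_a}\big)\star\big(\prod_b(1-bX)^{m_b}\big)=\prod_{a,b\in A}(1-abX)^{n_am_b}$ (independent of the chosen factorizations); with ordinary multiplication as addition it makes $P_A$ a commutative semiring (a semiring satisfies the axioms of a ring except that the additive structure is only a semigroup). *)

(* Defs.v *)
From HB Require Import structures.
From mathcomp Require Import all_boot all_order all_algebra finmap.
From mathcomp Require mpoly.
From mathcomp Require Import boolp classical_sets topology tvs.

Set Implicit Arguments.
Unset Strict Implicit.
Unset Printing Implicit Defensive.

Import GRing.Theory.

Local Open Scope classical_set_scope.
Local Open Scope ring_scope.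

HB.mixin Record TopologicalZmodule_isTopologicalRing M
    & Topological M & GRing.PzRing M := {
  mul_continuous : continuous (fun x : M * M => x.1 * x.2)
}.

#[short(type="topologicalComPzRingType")]
HB.structure Definition TopologicalComPzRing :=
  {M of TopologicalZmodule M & GRing.ComPzRing M
      & TopologicalZmodule_isTopologicalRing M}.

(* The clash between the notations of mpoly and those of mathcomp-analysis
   prevents importing mpoly at top level. *)
Module UniversalPolynomials.
Import mpoly.

Section Def.
Variable n : nat.

(* Z[X_1, ..., X_n, Y_1, ..., Y_n], also used as Z[U_1, .., U_n, V_1, .., V_n]:
   the first n variables are the X_k (resp. U_k), the last n ones are the Y_l
   (resp. V_l), all indexed from 0. Polynomials in T over this ring are elements
   of {poly {mpoly int[n + n]}}, where T is 'X. *)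
Definition varX (k : 'I_n) : {mpoly int[n + n]} := 'X_(lshift n k).
Definition varY (l : 'I_n) : {mpoly int[n + n]} := 'X_(rshift n l).

(* Signed elementary symmetric polynomials:
   Sigma z k is the coefficient of T^k in \prod_i (1 - z_i T). *)
Definition Sigma (z : 'I_n -> {mpoly int[n + n]}) (k : nat)
    : {mpoly int[n + n]} :=
  (\prod_(i < n) (1 - z i *: 'X))`_k.

Definition Sigmas : (n + n).-tuple {mpoly int[n + n]} :=
  [tuple match split i with
         | inl k => Sigma varX k.+1
         | inr l => Sigma varY l.+1
         end | i < n + n].

Definition is_universal (C : {mpoly int[n + n]}) : Prop :=
  C \mPo Sigmas
  = (\prod_(k < n) \prod_(l < n) (1 - (varX k * varY l) *: 'X))`_n.

(* For n >= 1, the only polynomial satisfying is_universal. *)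
Definition C : {mpoly int[n + n]} := xget 0 [set P | is_universal P].

End Def.

(* Value at v of a polynomial with integer coefficients; this is
   mmap intr v P, except that mmap excludes the zero ring. *)
Definition eval_int (A : comPzRingType) (m : nat) (P : {mpoly int[m]})
    (v : 'I_m -> A) : A :=
  \sum_(e <- msupp P) (P@_e)%:~R * \prod_(i < m) v i ^+ e i.

End UniversalPolynomials.

(* 1 + X A[[X]]; a power series is given by its sequence of coefficients. *)
Record pseries1 (A : comPzRingType) :=
  PSeries1 { pcoef :> nat -> A; pcoef0 : pcoef 0%N == 1 }.

HB.instance Definition _ (A : comPzRingType) := [isSub for @pcoef A].

Section PSeries1.
Variable A : comPzRingType.
Implicit Types (f g : pseries1 A) (a : A) (u v : {fsfun A -> nat with 0%N}).

(* 1 + \sum_(n >= 1) c_n X^n; the value c_0 is ignored. *)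
Definition mk_pseries1 (c : nat -> A) : pseries1 A :=
  @PSeries1 A (fun n => if n == 0%N then 1 else c n) (eqxx 1).

Definition ps_one : pseries1 A := mk_pseries1 (fun=> 0).

(* Cauchy product; its constant coefficient f_0 g_0 is indeed 1. *)
Definition ps_mul f g : pseries1 A :=
  mk_pseries1 (fun n => \sum_(i < n.+1) f i * g (n - i)%N).

Definition ps_exp f (k : nat) : pseries1 A := iter k (ps_mul f) ps_one.

Definition ps_lin a : pseries1 A := mk_pseries1 (fun n => - a *+ (n == 1%N)).

Definition ene f g : pseries1 A :=
  mk_pseries1 (fun n =>
    UniversalPolynomials.eval_int (UniversalPolynomials.C n)
      (fun i => match split i with
                | inl k => f k.+1
                | inr l => g l.+1
                end)).

(* 1 + X^n A[[X]], for n >= 1 *)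
Definition krull_subgroup (n : nat) : set (pseries1 A) :=
  [set f | forall i, (0 < i < n)%N -> f i = 0].

(* \prod_a (1 - a X)^(u_a) *)
Definition split_prod u : pseries1 A :=
  \big[ps_mul/ps_one]_(a <- finsupp u) ps_exp (ps_lin a) (u a).

Definition split_poly : set (pseries1 A) := range split_prod.

(* \prod_(a, b) (1 - a b X)^(u_a v_b) *)
Definition ene_split u v : pseries1 A :=
  \big[ps_mul/ps_one]_(a <- finsupp u) \big[ps_mul/ps_one]_(b <- finsupp v)
    ps_exp (ps_lin (a * b)) (u a * v b)%N.

End PSeries1.

Arguments krull_subgroup A n : clear implicits.
Arguments split_poly A : clear implicits.

(* The group topologies on a commutative group are determined by the
   neighborhoods of the neutral element. *)
Definition is_krull_topology (A : comPzRingType)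
    (cR : TopologicalComPzRing.axioms_ (pseries1 A)) : Prop :=
  let R : topologicalComPzRingType := TopologicalComPzRing.Pack cR in
  forall U : set R,
    nbhs (0 : R) U <-> exists2 n, (1 <= n)%N & krull_subgroup A n `<=` U.

(* Addition is the product of polynomials; the formula for the product has to
   hold for all the factorizations of p and q. *)
Definition is_ene_semiring (A : comPzRingType)
    (cS : GRing.ComPzSemiRing.axioms_ (split_poly A)) : Prop :=
  let S : comPzSemiRingType := GRing.ComPzSemiRing.Pack cS in
  (forall p q : split_poly A,
     \val ((p : S) + q : S) = ps_mul (\val p) (\val q)) /\
  (forall (p q : split_poly A) (u v : {fsfun A -> nat with 0%N}),
     \val p = split_prod u -> \val q = split_prod v ->
     \val ((p : S) * q : S) = ene_split u v).

(* Main.v *)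
Require Import Defs.
From HB Require Import structures.
From mathcomp Require Import all_boot all_order all_algebra finmap.
From mathcomp Require mpoly.
From mathcomp Require Import boolp classical_sets topology tvs.

(* After adjoining roots to A, every series agrees up to a given order with a
   product of factors 1 - aX, and on such products the eñe product multiplies
   the roots pairwise; the ring axioms are then identities between multisets of
   roots. The polynomial C_n exists because, for M with eigenvalues x_k and
   g = \prod_l (1 - y_l T), \det (g (T M)) = \prod_(k, l) (1 - x_k y_l T): when
   M is the companion matrix of the generic f, the coefficients of this
   determinant are polynomials in those of f and g. The first n coefficients of
   a sum, product or opposite only depend on those of the arguments, whence
   continuity. *)

Set Implicit Arguments.
Unset Strict Implicit.
Unset Printing Implicit Defensive.

Import GRing.Theory.

Local Open Scope ring_scope.

(** * Products of factors 1 - aX over lists of roots *)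

Section LinProd.
Variable B : comNzRingType.
Implicit Types (s x y : seq B) (a b : B).

Definition lin_prod s : {poly B} := \prod_(a <- s) (1 - a *: 'X).

Lemma lin_prod_cons a s : lin_prod (a :: s) = (1 - a *: 'X) * lin_prod s.
Proof. exact: big_cons. Qed.

Lemma lin_prod_cat x y : lin_prod (x ++ y) = lin_prod x * lin_prod y.
Proof. exact: big_cat. Qed.

Lemma coef0_lin_prod s : (lin_prod s)`_0 = 1.
Proof.
elim: s => [|a s IHs]; first by rewrite /lin_prod big_nil coefC.
by rewrite lin_prod_cons coef0M IHs mulr1 coefB coefC coefZ coefX mulr0 subr0.
Qed.

Lemma coefS_lin_prod_cons a s i :
  (lin_prod (a :: s))`_i.+1 = (lin_prod s)`_i.+1 - a * (lin_prod s)`_i.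
Proof.
by rewrite lin_prod_cons mulrBl mul1r coefB -scalerAl coefZ coefXM.
Qed.

Lemma size_lin_prod s : (size (lin_prod s) <= (size s).+1)%N.
Proof.
elim: s => [|a s IHs]; first by rewrite /lin_prod big_nil size_poly1.
apply/leq_sizeP => -[//|j]; rewrite ltnS => sj; rewrite coefS_lin_prod_cons.
by rewrite !(nth_default 0) ?mulr0 ?subr0 // (leq_trans IHs) // ltnW.
Qed.

(** Reversing the coefficients turns \prod (1 - aX) into the monic polynomial \prod (X - a), to
    which root adjunction and characteristic polynomials apply. *)
Lemma coef_lin_prod_rev s i : (i <= size s)%N ->
  (lin_prod s)`_i = (\prod_(a <- s) ('X - a%:P))`_(size s - i).
Proof.
elim: s i => [|a s IHs] [|i] //= le_i_s.
- by rewrite /lin_prod !big_nil.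
- have := lead_coef_prod_XsubC (a :: s) predT id.
  rewrite lead_coefE -big_filter filter_predT size_prod_XsubC /= => ->.
  by rewrite coef0_lin_prod.
rewrite coefS_lin_prod_cons subSS big_cons mulrBl coefB coefCM coefXM.
rewrite (IHs i) //; congr (_ - _); rewrite subn_eq0.
(* If i = [size s], the product by X has no constant term, and on the left the index i + 1 exceeds
   the degree of [lin_prod s]. *)
case: ltnP => [lt_i_s | le_s_i]; first by rewrite IHs // -subnS.
by rewrite nth_default // (leq_trans (size_lin_prod s)).
Qed.

(** Multiplying every root by b amounts to substituting bX for X. *)
Lemma coef_lin_prod_scale x b i :
  (lin_prod [seq a * b | a <- x])`_i = (lin_prod x)`_i * b ^+ i.
Proof.
elim: x i => [|a x IHx] [|i].
- by rewrite mulr1.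
- by rewrite /lin_prod !big_nil !coefC mul0r.
- by rewrite !coef0_lin_prod mulr1.
rewrite map_cons !coefS_lin_prod_cons !IHx exprS; set c := _`_i.+1.
by rewrite mulrBl mulrACA.
Qed.

Definition eq_upto n (p q : {poly B}) := forall i, (i <= n)%N -> p`_i = q`_i.

Lemma eq_uptoM n (p p' q q' : {poly B}) :
  eq_upto n p p' -> eq_upto n q q' -> eq_upto n (p * q) (p' * q').
Proof.
move=> pp' qq' i le_i_n; rewrite !coefM; apply: eq_bigr => j _.
by rewrite pp' ?qq' ?(leq_trans _ le_i_n) ?leq_subr // -ltnS.
Qed.

Lemma lin_prod_allpairsr x b y :
  lin_prod [seq a * c | a <- x, c <- b :: y]
  = lin_prod [seq a * b | a <- x] * lin_prod [seq a * c | a <- x, c <- y].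
Proof.
rewrite /lin_prod !big_allpairs_dep big_map -big_split /=.
by apply: eq_bigr => a _; rewrite big_cons.
Qed.

Lemma lin_prod_allpairsC x y :
  lin_prod [seq a * b | a <- x, b <- y] = lin_prod [seq a * b | a <- y, b <- x].
Proof.
rewrite /lin_prod !big_allpairs_dep exchange_big; apply: eq_bigr => b _.
by apply: eq_bigr => a _; rewrite mulrC.
Qed.

(** The factors attached to a given b in y form [lin_prod x] at bX, whose coefficients up to n only
    involve those of [lin_prod x]. The lists x and x' may have different lengths. *)
Lemma eq_upto_allpairsl n x x' y : eq_upto n (lin_prod x) (lin_prod x') ->
  eq_upto n (lin_prod [seq a * b | a <- x, b <- y])
            (lin_prod [seq a * b | a <- x', b <- y]).
Proof.
move=> xx'; elim: y => [|b y IHy].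
  move=> i _; rewrite /lin_prod !big_allpairs_dep.
  by rewrite !big1 // => a _; rewrite big_nil.
rewrite !lin_prod_allpairsr; apply: eq_uptoM => // i le_i_n.
by rewrite !coef_lin_prod_scale xx'.
Qed.

Lemma eq_upto_allpairs n x x' y y' :
  eq_upto n (lin_prod x) (lin_prod x') -> eq_upto n (lin_prod y) (lin_prod y') ->
  eq_upto n (lin_prod [seq a * b | a <- x, b <- y])
            (lin_prod [seq a * b | a <- x', b <- y']).
Proof.
move=> xx' yy' i le_i_n; rewrite (eq_upto_allpairsl _ xx') //.
by rewrite lin_prod_allpairsC (eq_upto_allpairsl _ yy') // lin_prod_allpairsC.
Qed.

End LinProd.

Lemma map_lin_prod (B B' : comNzRingType) (f : {rmorphism B -> B'}) (s : seq B) :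
  map_poly f (lin_prod s) = lin_prod (map f s).
Proof.
rewrite /lin_prod rmorph_prod big_map; apply: eq_bigr => a _.
by rewrite rmorphB rmorph1 /= map_polyZ map_polyX.
Qed.

Lemma map_allpairsM (B B' : comNzRingType) (f : {rmorphism B -> B'}) (x y : seq B) :
  map f [seq a * b | a <- x, b <- y] = [seq a * b | a <- map f x, b <- map f y].
Proof.
rewrite map_allpairs allpairs_mapl (allpairs_mapr (fun=> _)).
by apply: eq_allpairs => a b; rewrite rmorphM.
Qed.

(** * Adjunction of roots to a commutative ring *)

Lemma monic_splitting n (B : comNzRingType) (p : {poly B}) :
  p \is monic -> size p = n.+1 ->
  exists (B' : comNzRingType) (f : {rmorphism B -> B'}) (s : seq B'),
    [/\ injective f, size s = n & map_poly f p = \prod_(a <- s) ('X - a%:P)].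
Proof.
elim: n => [|n IHn] in B p *.
  move=> /monicP p1 sz_p; exists B, idfun, [::]; split=> //.
  rewrite map_poly_id // big_nil.
  have /size_poly1P[c _ pE] : size p == 1%N by rewrite sz_p.
  by move: p1; rewrite pE lead_coefC => ->.
(* The class of X in the quotient by p is a root of p, and constants embed because p is not
   constant. The quotient is taken modulo [mk_monic p], which is p itself as p is monic of positive
   degree. *)
move=> p_monic sz_p; pose g : {rmorphism {poly B} -> {poly %/ p}} := in_qpoly p.
have pK : mk_monic p = p by rewrite /mk_monic sz_p p_monic.
have g_inj : injective (g \o polyC).
  move=> a b /(congr1 val) /=; rewrite pK !Pdiv.Ring.rmodp_small.
  - exact: polyC_inj.
  - by rewrite sz_p size_polyC; case: (b != 0).
  - by rewrite sz_p size_polyC; case: (a != 0).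
have p_root : root (map_poly (g \o polyC) p) (g 'X).
  rewrite /root map_poly_comp horner_map -/(p \Po 'X) comp_polyXr.
  by apply/eqP; apply: val_inj; rewrite /= pK Pdiv.RingMonic.rmodpp.
have [q pE] := factor_theorem _ _ p_root.
have q_monic : q \is monic.
  by rewrite -(monicMr _ (monicXsubC (g 'X))) -pE monic_map.
have sz_q : size q = n.+1.
  apply/eqP; rewrite -eqSS -sz_p -(@size_map_poly_id0 _ _ (g \o polyC) p).
    rewrite pE size_Mmonic ?monicXsubC ?monic_neq0 //.
    by rewrite size_XsubC addn2.
  by rewrite (monicP p_monic) rmorph1 oner_neq0.
have [B' [f [s [f_inj sz_s qE]]]] := IHn _ q q_monic sz_q.
exists B', (f \o (g \o polyC)), (f (g 'X) :: s); split => [||].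
- exact: inj_comp.
- by rewrite /= sz_s.
rewrite map_poly_comp pE rmorphM /= qE big_cons mulrC.
by rewrite rmorphB /= map_polyX map_polyC.
Qed.

(** The truncation of c at order n, read backwards, is monic of degree n because c_0 = 1; its n
    roots in an extension give the factors 1 - aX. *)
Lemma splitting_upto n (B : comNzRingType) (c : nat -> B) : c 0%N = 1 ->
  exists (B' : comNzRingType) (f : {rmorphism B -> B'}) (s : seq B'),
    [/\ injective f, size s = n
      & forall i, (i <= n)%N -> f (c i) = (lin_prod s)`_i].
Proof.
move=> c0; pose p := \poly_(i < n.+1) c (n - i)%N.
have sz_p : size p = n.+1.
  by rewrite size_poly_eq //= subnn c0 oner_neq0.
have p_monic : p \is monic.
  by rewrite monicE lead_coefE sz_p coef_poly ltnSn subnn c0.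
have [B' [f [s [f_inj sz_s pE]]]] := monic_splitting p_monic sz_p.
exists B', f, s; split=> // i le_i_n.
rewrite coef_lin_prod_rev ?sz_s // -pE coef_map coef_poly ltnS leq_subr.
by rewrite subKn.
Qed.


(** * Determinants and characteristic polynomials *)

Lemma horner_char_poly (R : comNzRingType) n (M : 'M[R]_n) (c : R) :
  (char_poly M).[c] = \det (c%:M - M).
Proof.
rewrite -[LHS]/(horner_eval c (char_poly M)) -det_map_mx; congr (\det _).
rewrite raddfB /= map_scalar_mx /= /horner_eval hornerX; congr (_ - _).
by apply/matrixP => i j; rewrite !mxE hornerC.
Qed.

Lemma det_sub1_scale_field (F : fieldType) n (M : 'M[F]_n) (s : seq F) (c : F) :
    char_poly M = \prod_(a <- s) ('X - a%:P) ->
  \det (1%:M - c *: M) = \prod_(a <- s) (1 - a * c).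
Proof.
move=> charM.
have sz_s : size s = n.
  by apply: succn_inj; rewrite -(size_prod_XsubC s id) -charM size_char_poly.
have [-> | c_neq0] := eqVneq c 0.
  by rewrite scale0r subr0 det1 big1 // => a _; rewrite mulr0 subr0.
have -> : 1%:M - c *: M = c *: (c^-1%:M - M).
  by rewrite scalerBr scale_scalar_mx divff.
(* The scalar c^n is rewritten as a product of copies of c indexed by s, so that each factor 1/c - a
   receives one of them. *)
rewrite detZ -horner_char_poly charM horner_prod -sz_s -count_predT -iter_mulr_1.
rewrite -[iter _ _ _](big_const_seq _ _ s predT) -big_split; apply: eq_bigr => a _ /=.
by rewrite hornerXsubC mulrBr divff // mulrC.
Qed.

(* \det (1 - c M) is c^n times the characteristic polynomial at 1 / c, hence the
   passage to the fraction field. *)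
Lemma det_sub1_scale (R : idomainType) n (M : 'M[R]_n) (s : seq R) (c : R) :
    char_poly M = \prod_(a <- s) ('X - a%:P) ->
  \det (1%:M - c *: M) = \prod_(a <- s) (1 - a * c).
Proof.
move=> charM.
pose tofrac : {rmorphism R -> {fraction R}} := @FracField.tofrac R.
have tofrac_inj : injective tofrac by move=> a b /eqP; rewrite tofrac_eq => /eqP.
apply: tofrac_inj.
rewrite -det_map_mx raddfB /= map_mx1 map_mxZ.
rewrite (@det_sub1_scale_field _ _ _ (map tofrac s)).
  rewrite big_map rmorph_prod; apply: eq_bigr => a _.
  by rewrite rmorphB rmorph1 rmorphM.
rewrite -map_char_poly charM rmorph_prod big_map; apply: eq_bigr => a _.
by rewrite rmorphB /= map_polyX map_polyC.
Qed.

Lemma char_poly_surj (R : comNzRingType) n (p : {poly R}) :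
  p \is monic -> size p = n.+1 -> exists M : 'M[R]_n, char_poly M = p.
Proof.
move=> p_monic sz_p.
(* The companion matrix has dimension [(size p).-1]; in an existential statement this dimension can
   be rewritten without a cast. *)
have ex_M : exists M : 'M[R]_((size p).-1), char_poly M = p.
  by exists (companionmx p); exact: companionmxK.
by move: ex_M; rewrite sz_p.
Qed.

(** Evaluating \prod (1 - bT) at TM gives the product of the matrices 1 - bTM, and each has
    determinant \prod_a (1 - abT) by [det_sub1_scale] with c = bT. *)
Lemma det_horner_mx_lin_prod (R : idomainType) n (M : 'M[R]_n.+1) (x y : seq R) :
    char_poly M = \prod_(a <- x) ('X - a%:P) ->
  \det (horner_mx ('X *: map_mx polyC M) (map_poly polyC (lin_prod y)))
  = lin_prod [seq a * b | a <- x, b <- y].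
Proof.
move=> charM; rewrite map_lin_prod /lin_prod big_map rmorph_prod /=.
rewrite (big_morph (@determinant _ _) (@det_mulmx _ _) (det1 _ _)).
rewrite big_allpairs_dep exchange_big /=; apply: eq_bigr => b _.
rewrite rmorphB rmorph1 /= linearZ /= horner_mx_X scalerA.
rewrite (@det_sub1_scale _ _ _ (map polyC x)).
  by rewrite big_map; apply: eq_bigr => a _; rewrite mulrA -polyCM mul_polyC.
rewrite -map_char_poly charM rmorph_prod big_map; apply: eq_bigr => a _.
by rewrite rmorphB /= map_polyX map_polyC.
Qed.

(** * Existence and values of the universal polynomials *)

Module UniversalPolynomialsTheory.
Import mpoly UniversalPolynomials.

Lemma Sigma_lin_prod n (z : 'I_n -> {mpoly int[n + n]}) k :
  Sigma z k = (lin_prod (codom z))`_k.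
Proof. by rewrite /Sigma /lin_prod /codom /image_mem big_map big_enum. Qed.

Lemma universal_rhs n :
  \prod_(k < n) \prod_(l < n) (1 - (@varX n k * varY l) *: 'X)
  = lin_prod [seq a * b | a <- codom (@varX n), b <- codom (@varY n)].
Proof.
rewrite /lin_prod big_allpairs_dep /codom /image_mem big_map big_enum /=.
by apply: eq_bigr => k _; rewrite big_map big_enum.
Qed.

Lemma universal_exists n : exists P, @is_universal n.+1 P.
Proof.
pose R : idomainType := {mpoly int[n.+1 + n.+1]}.
(* [cU] and [cV] are the coefficients of the generic f and g, with constant term 1; variables being
   indexed from 0, order k corresponds to variable k - 1. The coefficients of f are reversed in p,
   as befits a characteristic polynomial. *)
pose cU k : R := if k is k'.+1 then 'X_(lshift n.+1 (inord k')) else 1.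
pose cV k : R := if k is k'.+1 then 'X_(rshift n.+1 (inord k')) else 1.
pose p : {poly R} := \poly_(i < n.+2) cU (n.+1 - i)%N.
pose q : {poly R} := \poly_(i < n.+2) cV i.
have sz_p : size p = n.+2 by rewrite size_poly_eq //= subnn oner_neq0.
have p_monic : p \is monic.
  by rewrite monicE lead_coefE sz_p coef_poly ltnSn subnn.
have [M charM] := char_poly_surj p_monic sz_p.
pose phi : {rmorphism R -> R} := comp_mpoly (Sigmas n.+1).
have phi_cU k : (k <= n.+1)%N -> phi (cU k) = (lin_prod (codom (@varX n.+1)))`_k.
  case: k => [|k] lt_k_n; first by rewrite rmorph1 coef0_lin_prod.
  rewrite /phi /= comp_mpolyXU -tnth_nth tnth_mktuple (unsplitK (inl _)).
  by rewrite inordK // Sigma_lin_prod.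
have phi_cV k : (k <= n.+1)%N -> phi (cV k) = (lin_prod (codom (@varY n.+1)))`_k.
  case: k => [|k] lt_k_n; first by rewrite rmorph1 coef0_lin_prod.
  rewrite /phi /= comp_mpolyXU -tnth_nth tnth_mktuple (unsplitK (inr _)).
  by rewrite inordK // Sigma_lin_prod.
have phi_p : map_poly phi p = \prod_(a <- codom (@varX n.+1)) ('X - a%:P).
  apply/polyP => i; rewrite coef_map coef_poly ltnS.
  have sz_x : size (codom (@varX n.+1)) = n.+1 by rewrite size_codom card_ord.
  case: leqP => [le_i_n|lt_n_i].
    rewrite [LHS](phi_cU _ (leq_subr _ _)) coef_lin_prod_rev sz_x ?leq_subr //.
    by rewrite subKn.
  by rewrite raddf0 nth_default // size_prod_XsubC sz_x.
have phi_q : map_poly phi q = lin_prod (codom (@varY n.+1)).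
  apply/polyP => i; rewrite coef_map coef_poly ltnS.
  have sz_y : size (codom (@varY n.+1)) = n.+1 by rewrite size_codom card_ord.
  case: leqP => [le_i_n|lt_n_i]; first exact: phi_cV.
  by rewrite raddf0 nth_default // (leq_trans (size_lin_prod _)) ?sz_y.
exists (\det (horner_mx ('X *: map_mx polyC M) (map_poly polyC q)))`_n.+1.
(* The substitution [phi] commutes with coefficients, determinants and evaluation at a matrix, so M
   becomes [map_mx phi M], whose characteristic polynomial splits with roots X_k. *)
rewrite /is_universal universal_rhs -[LHS]/(phi _) -coef_map -det_map_mx map_horner_mx.
rewrite map_mxZ /= map_polyX -!map_mx_comp -!map_poly_comp.
rewrite (eq_map_mx _ (map_polyC phi)) (eq_map_poly (map_polyC phi)).
rewrite (map_mx_comp phi) (map_poly_comp polyC phi) phi_q.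
rewrite (det_horner_mx_lin_prod (x := codom (@varX n.+1))); last first.
  by rewrite -map_char_poly charM.
by [].
Qed.
Lemma C_universal n : is_universal (C n.+1).
Proof. exact: (xgetPex 0 (universal_exists n)). Qed.

Lemma eval_int_rmorph (A B : comPzRingType) (f : {rmorphism A -> B}) m
    (P : {mpoly int[m]}) (v : 'I_m -> A) :
  f (eval_int P v) = eval_int P (f \o v).
Proof.
rewrite rmorph_sum; apply: eq_bigr => e _; rewrite rmorphM rmorph_int rmorph_prod.
by congr (_ * _); apply: eq_bigr => i _; rewrite rmorphXn.
Qed.

Lemma eq_eval_int (A : comPzRingType) m (P : {mpoly int[m]}) (v w : 'I_m -> A) :
  v =1 w -> eval_int P v = eval_int P w.
Proof.
move=> vw; apply: eq_bigr => e _; congr (_ * _).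
by apply: eq_bigr => i _; rewrite vw.
Qed.

(** Over a nonzero ring [eval_int] is [mmap intr] by conversion, hence a ring morphism in the
    polynomial. *)
Lemma eval_int_comp (B : comNzRingType) m k (P : {mpoly int[m]})
    (t : m.-tuple {mpoly int[k]}) (v : 'I_k -> B) :
  eval_int (P \mPo t) v = eval_int P (fun i => eval_int (tnth t i) v).
Proof.
pose ev : {rmorphism {mpoly int[k]} -> B} := mmap intr v.
rewrite -[LHS]/(ev _) /comp_mpoly {1}/mmap rmorph_sum; apply: eq_bigr => e _.
rewrite rmorphM /ev /= mmapC; congr (_ * _).
rewrite -[LHS]/(ev _) rmorph_prod; apply: eq_bigr => i _.
by rewrite rmorphXn.
Qed.

Lemma map_codom_nth (B : comNzRingType) n (x : seq B) (T : Type) (h : 'I_n -> T)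
    (e : T -> B) :
  size x = n -> (forall i, e (h i) = x`_i) -> map e (codom h) = x.
Proof.
move=> sz_x eh; apply: (@eq_from_nth _ 0).
  by rewrite size_map size_codom card_ord sz_x.
move=> i; rewrite size_map size_codom card_ord => lt_i_n.
rewrite /codom /image_mem -map_comp (nth_map (Ordinal lt_i_n)) ?size_enum_ord //.
by rewrite /= eh nth_enum_ord.
Qed.

(** This is the identity defining [C] specialized at X = x and Y = y, whence the exact number of
    roots on each side. *)
Lemma eval_int_C (B : comNzRingType) n (x y : seq B) :
    size x = n.+1 -> size y = n.+1 ->
  eval_int (C n.+1) (fun i => match split i with
                              | inl k => (lin_prod x)`_k.+1
                              | inr l => (lin_prod y)`_l.+1
                              end)
  = (lin_prod [seq a * b | a <- x, b <- y])`_n.+1.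
Proof.
move=> sz_x sz_y; pose v (i : 'I_(n.+1 + n.+1)) :=
  match split i with inl k => x`_k | inr l => y`_l end.
pose ev : {rmorphism {mpoly int[n.+1 + n.+1]} -> B} := mmap intr v.
have evX : map ev (codom (@varX n.+1)) = x.
  apply: map_codom_nth => // i.
  by rewrite /ev /= mmapX mmap1U /v (unsplitK (inl _)).
have evY : map ev (codom (@varY n.+1)) = y.
  apply: map_codom_nth => // i.
  by rewrite /ev /= mmapX mmap1U /v (unsplitK (inr _)).
have := congr1 ev (C_universal n).
rewrite universal_rhs -coef_map map_lin_prod map_allpairsM evX evY => <-.
rewrite [RHS]eval_int_comp; apply: eq_eval_int => i; rewrite tnth_mktuple.
case: (split i) => k.
  transitivity (ev (Sigma (@varX n.+1) k.+1)); last by [].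
  by rewrite Sigma_lin_prod -(coef_map ev) map_lin_prod evX.
transitivity (ev (Sigma (@varY n.+1) k.+1)); last by [].
  by rewrite Sigma_lin_prod -(coef_map ev) map_lin_prod evY.
Qed.

End UniversalPolynomialsTheory.

(** * Series that split up to a given order in an extension *)

Definition splits_upto (B : comNzRingType) n (c : nat -> B) (s : seq B) :=
  forall i, (i <= n)%N -> c i = (lin_prod s)`_i.

Lemma splits_upto_map (B B' : comNzRingType) (f : {rmorphism B -> B'}) n c s :
  splits_upto n c s -> splits_upto n (f \o c) (map f s).
Proof. by move=> cs i le_i_n; rewrite -map_lin_prod coef_map /= cs. Qed.

Section PSeries1Split.
Variables (A B : comNzRingType) (iota : {rmorphism A -> B}) (n : nat).
Implicit Types (f g : pseries1 A) (x y : seq B).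

Lemma splits_upto_ps_mul f g x y :
    splits_upto n (iota \o f) x -> splits_upto n (iota \o g) y ->
  splits_upto n (iota \o ps_mul f g) (x ++ y).
Proof.
move=> fx gy [_|i le_i_n]; first by rewrite /= rmorph1 coef0_lin_prod.
rewrite lin_prod_cat coefM /= rmorph_sum; apply: eq_bigr => j _.
have le_j_n : (j <= n)%N by rewrite (leq_trans _ le_i_n) // -ltnS.
by rewrite rmorphM -fx // -gy // (leq_trans (leq_subr _ _)).
Qed.

Import UniversalPolynomials UniversalPolynomialsTheory.

(** [eval_int_C] computes coefficient i + 1 from exactly i + 1 roots on each side, whereas x and y
    have arbitrary lengths. They are replaced, over a larger ring, by lists x' and y' of that length
    with the same [lin_prod] up to order i + 1; by [eq_upto_allpairs] the pairwise product is the
    same up to that order. *)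
Lemma splits_upto_ene f g x y :
    splits_upto n (iota \o f) x -> splits_upto n (iota \o g) y ->
  splits_upto n (iota \o ene f g) [seq a * b | a <- x, b <- y].
Proof.
move=> fx gy [_|i le_i_n]; first by rewrite /= rmorph1 coef0_lin_prod.
have [B1 [k1 [x' [k1_inj sz_x' xx']]]] := splitting_upto i.+1 (coef0_lin_prod x).
(* The second splitting takes place over B1, so that both lists have images in the single ring
   B2. *)
have [|B2 [k2 [y' [k2_inj sz_y' yy']]]] :=
  @splitting_upto i.+1 B1 (k1 \o (fun j => (lin_prod y)`_j)).
  by rewrite /= coef0_lin_prod rmorph1.
apply: (inj_comp k2_inj k1_inj) => /=; rewrite !eval_int_rmorph.
rewrite -!coef_map !map_lin_prod !map_allpairsM /=.
have xx'' : eq_upto i.+1 (lin_prod (map k2 x')) (lin_prod (map k2 (map k1 x))).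
  by move=> j le_j_i; rewrite -!map_lin_prod !coef_map /= -xx'.
have yy'' : eq_upto i.+1 (lin_prod y') (lin_prod (map k2 (map k1 y))).
  by move=> j le_j_i; rewrite -!map_lin_prod !coef_map /= -yy'.
rewrite -(eq_upto_allpairs xx'' yy'') // -eval_int_C ?size_map //.
apply: eq_eval_int => j /=; case: (split j) => k /=.
  have /= -> := fx k.+1 (leq_trans (ltn_ord k) le_i_n).
  by rewrite (xx'' _ (ltn_ord k)) -!map_lin_prod !coef_map.
have /= -> := gy k.+1 (leq_trans (ltn_ord k) le_i_n).
by rewrite (yy'' _ (ltn_ord k)) -!map_lin_prod !coef_map.
Qed.

End PSeries1Split.

Lemma pseries1P (A : comPzRingType) (f g : pseries1 A) : f =1 g -> f = g.
Proof. by move=> fg; apply: val_inj; apply/funext. Qed.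

Lemma pseries1_zero_ring (A : comPzRingType) (f g : pseries1 A) :
  1 = 0 :> A -> f = g.
Proof.
by move=> A0; apply: pseries1P => n; rewrite -[f n]mulr1 -[g n]mulr1 A0 !mulr0.
Qed.

(** Splitting arguments take place over nonzero rings; over the zero ring all series are equal. The
    statement has the shape of an eliminator, for use with [elim/]. *)
Lemma nonzero_ring_wlog (P : comPzRingType -> Prop) :
    (forall A : comNzRingType, P A) ->
    (forall A : comPzRingType, 1 = 0 :> A -> P A) ->
  forall A, P A.
Proof.
move=> PNz Pz [T c]; pose A := GRing.ComPzRing.Pack c.
have [A0|A_neq0] := eqVneq (1 : A) 0; first exact: (Pz A).
pose nzM := GRing.PzSemiRing_isNonZero.Build A A_neq0.
pose A' : comNzRingType := HB.pack T A nzM.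
exact: (PNz A').
Qed.

(** Equality is tested one coefficient at a time, so the extension may depend on n; injectivity
    brings the equality back to A. *)
Lemma pseries1_eqP (A : comNzRingType) (f g : pseries1 A) :
    (forall n, exists (B : comNzRingType) (iota : {rmorphism A -> B}) (s : seq B),
      [/\ injective iota, splits_upto n (iota \o f) s
        & splits_upto n (iota \o g) s]) ->
  f = g.
Proof.
move=> fg; apply: pseries1P => n; have [B [iota [s [iota_inj fs gs]]]] := fg n.
by apply: iota_inj; rewrite [LHS]fs // [RHS]gs.
Qed.

(** The ring axioms involve at most three series. They are split one after the other, the roots
    already found being mapped into each new extension. *)
Lemma pseries1_splitting (A : comNzRingType) (f g h : pseries1 A) n :
  exists (B : comNzRingType) (iota : {rmorphism A -> B}) (x y z : seq B),
  [/\ injective iota, splits_upto n (iota \o f) x,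
      splits_upto n (iota \o g) y & splits_upto n (iota \o h) z].
Proof.
have c1 (B : comNzRingType) (k : {rmorphism A -> B}) (p : pseries1 A) :
  (k \o p) 0%N = 1 by rewrite /= (eqP (pcoef0 p)) rmorph1.
have [B1 [k1 [x [k1_inj _ fx]]]] := splitting_upto n (c1 _ idfun f).
have [B2 [k2 [y [k2_inj _ gy]]]] := splitting_upto n (c1 _ k1 g).
have [B3 [k3 [z [k3_inj _ hz]]]] := splitting_upto n (c1 _ (k2 \o k1) h).
exists B3, (k3 \o (k2 \o k1)), (map k3 (map k2 x)), (map k3 y), z; split=> //.
- exact: (inj_comp k3_inj (inj_comp k2_inj k1_inj)).
- by apply: (splits_upto_map k3); apply: (splits_upto_map k2).
- exact: (splits_upto_map k3).
Qed.

(** * The ring axioms *)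

Section PSeries1Ring.
Variable A : comPzRingType.
Implicit Types f g h : pseries1 A.

Lemma ps_mulC : commutative (@ps_mul A).
Proof.
move=> f g; apply: pseries1P => -[//|n] /=.
rewrite (reindex_inj rev_ord_inj); apply: eq_bigr => i _ /=.
by rewrite mulrC subSS subKn // -ltnS.
Qed.

Lemma ps_mul1 : left_id (@ps_one A) (@ps_mul A).
Proof.
move=> f; apply: pseries1P => -[|n] /=; first by rewrite (eqP (pcoef0 f)).
by rewrite big_ord_recl /= mul1r subn0 big1 ?addr0 // => i _; rewrite mul0r.
Qed.

Lemma ps_mulA : associative (@ps_mul A).
Proof.
elim/nonzero_ring_wlog: A => [A' | A' A0] f g h; last exact: pseries1_zero_ring.
apply: pseries1_eqP => n.
have [B [iota [x [y [z [iota_inj fx gy hz]]]]]] := pseries1_splitting f g h n.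
exists B, iota, (x ++ y ++ z); split=> //; first by do !apply: splits_upto_ps_mul.
by rewrite catA; do !apply: splits_upto_ps_mul.
Qed.

Lemma eneC : commutative (@ene A).
Proof.
elim/nonzero_ring_wlog: A => [A' | A' A0] f g; last exact: pseries1_zero_ring.
apply: pseries1_eqP => n.
have [B [iota [x [y [_ [iota_inj fx gy _]]]]]] := pseries1_splitting f g f n.
exists B, iota, [seq a * b | a <- x, b <- y]; split=> //.
  exact: splits_upto_ene.
by move=> i le_i_n; rewrite lin_prod_allpairsC (splits_upto_ene gy fx).
Qed.

Lemma eneA : associative (@ene A).
Proof.
elim/nonzero_ring_wlog: A => [A' | A' A0] f g h; last exact: pseries1_zero_ring.
apply: pseries1_eqP => n.
have [B [iota [x [y [z [iota_inj fx gy hz]]]]]] := pseries1_splitting f g h n.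
exists B, iota, [seq a * b | a <- x, b <- [seq b * c | b <- y, c <- z]].
split=> //; first by do !apply: splits_upto_ene.
have xyz := splits_upto_ene (splits_upto_ene fx gy) hz.
(* Both bracketings enumerate the triple products in the same order, leaving only associativity in
   B. *)
move=> i le_i_n; rewrite xyz //; congr (polyseq _)`_i.
rewrite /lin_prod !big_allpairs_dep; apply: eq_bigr => a _.
rewrite !big_allpairs_dep; apply: eq_bigr => b _.
by apply: eq_bigr => c _; rewrite mulrA.
Qed.

Lemma eneDl : left_distributive (@ene A) (@ps_mul A).
Proof.
elim/nonzero_ring_wlog: A => [A' | A' A0] f g h; last exact: pseries1_zero_ring.
apply: pseries1_eqP => n.
have [B [iota [x [y [z [iota_inj fx gy hz]]]]]] := pseries1_splitting f g h n.
exists B, iota, [seq a * b | a <- x ++ y, b <- z]; split=> //.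
  by apply: splits_upto_ene => //; apply: splits_upto_ps_mul.
by rewrite allpairs_cat; apply: splits_upto_ps_mul; exact: splits_upto_ene.
Qed.

Lemma splits_upto_ps_lin (A' : comNzRingType) n (a : A') :
  splits_upto n (ps_lin a) [:: a].
Proof.
move=> i _; rewrite /lin_prod big_seq1 coefB coefZ coefX coefC /=.
by case: i => [|[|i]]; rewrite ?mulr0 ?mulr1 ?subr0 ?sub0r.
Qed.

Lemma ene_ps_lin (a b : A) : ene (ps_lin a) (ps_lin b) = ps_lin (a * b).
Proof.
elim/nonzero_ring_wlog: A a b => [A' | A' A0] a b; last exact: pseries1_zero_ring.
apply: pseries1_eqP => n.
exists A', idfun, [:: a * b]; split=> //; last exact: splits_upto_ps_lin.
by apply: (@splits_upto_ene _ _ idfun _ _ _ [:: a] [:: b]); exact: splits_upto_ps_lin.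
Qed.

(** The only root of 1 - X is 1, and multiplication by it fixes the roots of the other series. *)
Lemma ene1 : left_id (ps_lin 1) (@ene A).
Proof.
elim/nonzero_ring_wlog: A => [A' | A' A0] f; last exact: pseries1_zero_ring.
apply: pseries1_eqP => n.
have [B [iota [x [_ [_ [iota_inj fx _ _]]]]]] := pseries1_splitting f f f n.
exists B, iota, [seq a * b | a <- [:: 1], b <- x]; split=> //.
  apply: splits_upto_ene => //.
  have -> : [:: 1] = map iota [:: 1] by rewrite /= rmorph1.
  by apply: splits_upto_map; exact: splits_upto_ps_lin.
by rewrite /= cats0 (eq_map (@mul1r _)) map_id.
Qed.

(** The equation f g = 1 is solved for the coefficient of g of order n, which involves all the
    earlier ones: hence the list of them carried along. *)
Fixpoint ps_inv_seq f n : seq A :=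
  if n is m.+1 then
    let s := ps_inv_seq f m in
    rcons s (- \sum_(i < n) f i.+1 * s`_(m - i))
  else [:: 1].

Definition ps_inv f : pseries1 A := mk_pseries1 (fun n => (ps_inv_seq f n)`_n).

Lemma size_ps_inv_seq f n : size (ps_inv_seq f n) = n.+1.
Proof. by elim: n => //= n IHn; rewrite size_rcons IHn. Qed.

Lemma nth_ps_inv_seq f n i : (i <= n)%N -> (ps_inv_seq f n)`_i = ps_inv f i.
Proof.
elim: n => [|n IHn]; first by case: i.
rewrite leq_eqVlt => /predU1P[-> //|lt_i_n] /=.
by rewrite nth_rcons size_ps_inv_seq lt_i_n IHn.
Qed.

Lemma ps_mulNf : left_inverse (@ps_one A) ps_inv (@ps_mul A).
Proof.
move=> f; rewrite ps_mulC; apply: pseries1P => -[//|n].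
rewrite /= big_ord_recl (eqP (pcoef0 f)) mul1r subn0 /=.
rewrite nth_rcons size_ps_inv_seq ltnn eqxx addrC; apply/eqP.
rewrite subr_eq0; apply/eqP; apply: eq_bigr => i _.
by rewrite [in RHS]nth_ps_inv_seq ?leq_subr.
Qed.

End PSeries1Ring.

Local Open Scope classical_set_scope.

HB.instance Definition _ (A : comPzRingType) := [Choice of pseries1 A by <:].
(** From here on, ring notations on series denote the eñe ring: [0] is the series 1, and [1] will be
    1 - X. *)
HB.instance Definition _ (A : comPzRingType) := GRing.isZmodule.Build (pseries1 A)
  (@ps_mulA A) (@ps_mulC A) (@ps_mul1 A) (@ps_mulNf A).
HB.instance Definition _ (A : comPzRingType) :=
  GRing.Zmodule_isComPzRing.Build (pseries1 A)
  (@eneA A) (@eneC A) (@ene1 A) (@eneDl A).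

(** * The Krull topology *)

Section Krull.
Variable A : comPzRingType.
Implicit Types (f g : pseries1 A) (U : set (pseries1 A)).

(** This is congruence modulo X^n, whose classes are the cosets of the subgroup 1 + X^n A[[X]]. *)
Definition agree n f g := forall i, (i < n)%N -> f i = g i.

Lemma agree_ps_mul n f f' g g' :
  agree n f f' -> agree n g g' -> agree n (ps_mul f g) (ps_mul f' g').
Proof.
move=> ff' gg' [//|i] lt_i_n; apply: eq_bigr => j _.
rewrite ff' ?gg' // (leq_ltn_trans _ lt_i_n) ?leq_subr //.
by rewrite -ltnS.
Qed.

Lemma agree_ene n f f' g g' :
  agree n f f' -> agree n g g' -> agree n (ene f g) (ene f' g').
Proof.
move=> ff' gg' [//|i] lt_i_n; apply: UniversalPolynomialsTheory.eq_eval_int => j.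
by case: (split j) => k; rewrite (ff', gg') ?(leq_ltn_trans (ltn_ord k)).
Qed.

Lemma agree_ps_inv n f f' : agree n f f' -> agree n (ps_inv f) (ps_inv f').
Proof.
move=> ff'; have inv_seq i : (i < n)%N -> ps_inv_seq f i = ps_inv_seq f' i.
  elim: i => // i IHi lt_i_n /=; rewrite IHi ?(ltnW lt_i_n) //.
  congr (rcons _ (- _)); apply: eq_bigr => j _.
  by rewrite ff' ?(leq_ltn_trans (ltn_ord j)).
by case=> // i lt_i_n; rewrite /= -/(ps_inv_seq _ i.+1) inv_seq.
Qed.

Definition ps_nbhs f : set_system (pseries1 A) :=
  [set U | exists n, agree n f `<=` U].

HB.instance Definition _ := hasNbhs.Build (pseries1 A) ps_nbhs.

Lemma ps_nbhs_filter f : ProperFilter (nbhs f).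
Proof.
split=> [[n /(_ f)]|]; first by apply.
split=> [|U V [n nU] [m mV]|U V UV [n nU]]; first by exists 0%N.
  exists (maxn n m) => g fg; split.
    by apply: nU => i lt_i_n; rewrite fg // leq_max lt_i_n.
  by apply: mV => i lt_i_m; rewrite fg // leq_max lt_i_m orbT.
by exists n; apply: subset_trans UV.
Qed.

Lemma ps_nbhs_singleton f U : nbhs f U -> U f.
Proof. by case=> n; apply. Qed.

Lemma ps_nbhs_nbhs f U : nbhs f U -> nbhs f (nbhs^~ U).
Proof.
(* Congruence being transitive, the same n serves at every point g of the class of f. *)
case=> n nU; exists n => g fg; exists n => h gh; apply: nU => i lt_i_n.
by rewrite fg // gh.
Qed.

HB.instance Definition _ := Nbhs_isNbhsTopological.Build (pseries1 A)
  ps_nbhs_filter ps_nbhs_singleton ps_nbhs_nbhs.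

Lemma agree_continuous (op : pseries1 A -> pseries1 A -> pseries1 A) :
    (forall n f f' g g', agree n f f' -> agree n g g' ->
       agree n (op f g) (op f' g')) ->
  continuous (fun x : pseries1 A * pseries1 A => op x.1 x.2).
Proof.
(* Precision n on both arguments gives precision n on the result. *)
move=> op_agree [f g] U [n nU]; exists (agree n f, agree n g).
  by split; exists n.
by move=> [f' g'] [/= ff' gg']; apply: nU; exact: op_agree.
Qed.

Lemma ps_opp_continuous : continuous (-%R : pseries1 A -> pseries1 A).
Proof.
by move=> f U [n nU]; exists n => g fg; apply: nU; exact: agree_ps_inv.
Qed.

HB.instance Definition _ :=
  PreTopologicalNmodule_isTopologicalNmodule.Build (pseries1 A)
    (agree_continuous agree_ps_mul).
HB.instance Definition _ :=
  TopologicalNmodule_isTopologicalZmodule.Build (pseries1 A) ps_opp_continuous.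
HB.instance Definition _ :=
  TopologicalZmodule_isTopologicalRing.Build (pseries1 A)
    (agree_continuous agree_ene).

End Krull.

Lemma krull_topologyP (A : comPzRingType) :
  is_krull_topology (TopologicalComPzRing.class (pseries1 A)).
Proof.
move=> U; split=> [[n nU] | [n n_gt0 nU]].
  (* The successor makes the index positive, as n may be 0 here. *)
  exists n.+1 => // f f0; apply: nU => -[|i] lt_i_n.
    by rewrite (eqP (pcoef0 f)).
  by rewrite f0 //= ltnW.
by exists n => f f0; apply: nU => -[//|i] lt_i_n; rewrite -f0.
Qed.

(** * The semiring of split polynomials *)

Section SplitPoly.
Variable A : comPzRingType.
Implicit Types (u v : {fsfun A -> nat with 0%N}).

Lemma ps_expE (f : pseries1 A) n : ps_exp f n = f *+ n.
Proof. by elim: n => [//|n IHn]; rewrite mulrS -IHn. Qed.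

Lemma split_prodE u : split_prod u = \sum_(a <- finsupp u) ps_lin a *+ u a.
Proof. by apply: eq_bigr => a _; rewrite ps_expE. Qed.

(** Distributivity reduces this to linear factors. The right-hand side only depends on the two
    polynomials, so the product formula is independent of the factorizations. *)
Lemma ene_split_prod u v : ene_split u v = split_prod u * split_prod v.
Proof.
rewrite !split_prodE mulr_suml; apply: eq_bigr => a _.
rewrite mulr_sumr; apply: eq_bigr => b _.
rewrite ps_expE mulrnAl mulrnAr -mulrnA [in RHS]mulnC; congr (_ *+ _).
exact: esym (ene_ps_lin a b).
Qed.

(** With lists of roots in place of multiplicities, closure under the operations becomes
    concatenation and pairwise multiplication. *)
Lemma split_polyP (f : pseries1 A) :
  split_poly A f <-> exists s : seq A, f = \sum_(a <- s) ps_lin a.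
Proof.
split=> [[u _ <-] | [s ->]].
  exists (flatten [seq nseq (u a) a | a <- finsupp u]).
  rewrite split_prodE big_flatten big_map; apply: eq_bigr => a _.
  by rewrite big_nseq -Monoid.iteropE.
pose u : {fsfun A -> nat with 0%N} :=
  [fsfun a in [fset a | a in s]%fset => count_mem a s].
have uE a : u a = count_mem a s.
  by rewrite fsfunE inE; case: ifP => // /count_memPn.
exists u => //; rewrite split_prodE.
rewrite -[RHS]big_undup_iterop_count (perm_big (undup s)) /=.
  by apply: eq_bigr => a _; rewrite uE.
apply: uniq_perm; rewrite ?undup_uniq ?fset_uniq // => a.
by rewrite mem_undup mem_finsupp uE -lt0n -has_count has_pred1.
Qed.

(* Unlike its unfolding, a type {x | _}, this alias can carry instances. *)
Definition split_poly_type : Type := split_poly A.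
HB.instance Definition _ := SubChoice.on split_poly_type.

Lemma split_poly_semiring_closed : semiring_closed (mem (split_poly A)).
Proof.
split; split.
- by rewrite inE; apply/split_polyP; exists [::]; rewrite big_nil.
- move=> f g; rewrite !inE => /split_polyP[s ->] /split_polyP[t ->].
  by apply/split_polyP; exists (s ++ t); rewrite big_cat.
- by rewrite inE; apply/split_polyP; exists [:: 1]; rewrite big_seq1.
move=> f g; rewrite !inE => /split_polyP[s ->] /split_polyP[t ->].
apply/split_polyP; exists [seq a * b | a <- s, b <- t].
rewrite big_allpairs_dep mulr_suml; apply: eq_bigr => a _.
by rewrite mulr_sumr; apply: eq_bigr => b _; rewrite -ene_ps_lin.
Qed.

HB.instance Definition _ := GRing.SubChoice_isSubComPzSemiRing.Build
  (pseries1 A) _ split_poly_type split_poly_semiring_closed.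
End SplitPoly.

Theorem corollary0p11 (A : comPzRingType) :
  exists cR : TopologicalComPzRing.axioms_ (pseries1 A),
  let R : topologicalComPzRingType := TopologicalComPzRing.Pack cR in
  [/\ forall f g : pseries1 A, (f : R) + g = ps_mul f g,
      forall f g : pseries1 A, (f : R) * g = ene f g,
      is_krull_topology cR
    & exists cS : GRing.ComPzSemiRing.axioms_ (split_poly A),
      let S : comPzSemiRingType := GRing.ComPzSemiRing.Pack cS in
      [/\ is_ene_semiring cS,
          GRing.nmod_morphism (fun p : S => \val p : R)
        & GRing.monoid_morphism (fun p : S => \val p : R)]].
Proof.
exists (TopologicalComPzRing.class (pseries1 A)); split=> //.
  exact: krull_topologyP.
(* The operations on split polynomials are restrictions of those of the ring, so the inclusion is a
   morphism by construction; [ene_split_prod] covers all factorizations. *)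
exists (GRing.ComPzSemiRing.class (split_poly_type A)); split=> //.
by split=> // p q u v pu qv; rewrite ene_split_prod -pu -qv.
Qed.
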